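(* Consider a PFCT-S instance with sources $[n]$, sinks $[m]$, supplies $(a_i)$, demands $(b_j)$ and costs $(f_i)$, where $f_1\ge\cdots\ge f_n$ and $b_1\ge\cdots\ge b_m$. Let $x^*$ be an optimum solution, and assume that every sink $j\in[m]$ has exactly one source $i$ with $x^*_{ij}>0$. Let $\epsilon>0$ be a sufficiently small constant. Then there is a feasible solution $x$ whose cost is at most $(1+\epsilon)$ times the optimum cost, such that the $n/\epsilon$ most expensive edges in $\mathrm{supp}(x)$ are all incident to sinks in $[n/\epsilon]$.
   Context: A PFCT-S instance: sources $S=[n]$ with supplies $a_i\in\mathbb{Z}_{>0}$ and fixed costs $f_i\ge0$; sinks $T=[m]$ with demands $b_j\in\mathbb{Z}_{>0}$; $\sum_ia_i=\sum_jb_j$. Feasible solutions are $x\in\mathbb{R}_{\ge0}^{S\times T}$ with $\sum_jx_{ij}=a_i$ and $\sum_ix_{ij}=b_j$; cost is $\sum_{i,j}\mathbf{1}_{x_{ij}>0}f_i$. $\mathrm{supp}(x)=\{(i,j):x_{ij}\ne0\}$; an edge $(i,j)$ has cost $f_i$. $1/\epsilon$ is assumed to be an integer. *)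

(* Defs.v *)
From HB Require Import structures.
From mathcomp Require Import all_boot all_order all_algebra.
From mathcomp Require Import reals.

Set Implicit Arguments.
Unset Strict Implicit.
Unset Printing Implicit Defensive.

Import Order.TTheory GRing.Theory Num.Theory.
Local Open Scope ring_scope.

(* Sources and sinks are 0-indexed: [n] is 'I_n and [m] is 'I_m. *)
Record PFCTS (R : realType) (n m : nat) := {
  supply : 'I_n -> nat;
  demand : 'I_m -> nat;
  fixed_cost : 'I_n -> R;
  supply_gt0 : forall i, (0 < supply i)%N;
  demand_gt0 : forall j, (0 < demand j)%N;
  fixed_cost_ge0 : forall i, 0 <= fixed_cost i;
  balanced : (\sum_i supply i = \sum_j demand j)%N
}.

Section PFCTS_theory.
Variables (R : realType) (n m : nat) (P : PFCTS R n m).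
Implicit Type x : 'M[R]_(n, m).

Definition feasible x : Prop :=
  [/\ forall i j, 0 <= x i j,
      forall i, \sum_j x i j = (supply P i)%:R
    & forall j, \sum_i x i j = (demand P j)%:R].

Definition cost x : R :=
  \sum_i \sum_j (if 0 < x i j then fixed_cost P i else 0).

Definition optimum x : Prop :=
  feasible x /\ forall y, feasible y -> cost x <= cost y.

Definition supp x : {set 'I_n * 'I_m} := [set e | x e.1 e.2 != 0].

Definition edge_cost (e : 'I_n * 'I_m) : R := fixed_cost P e.1.

(* E is a possible choice of the k most expensive edges of A. All edges at a
   source have the same cost, so this choice is in general not unique. When A
   has fewer than k edges, E is all of A. *)
Definition most_expensive (k : nat) (A E : {set 'I_n * 'I_m}) : Prop :=
  [/\ E \subset A,
      #|E| = minn k #|A|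
    & forall e e', e \in E -> e' \in A :\: E -> edge_cost e' <= edge_cost e].

End PFCTS_theory.

(* Main.v *)
(** In the optimum every source [i] serves whole sinks, [d i] in number.
Put [Q = n / eps] and let [c] be the source of the [Q]-th most expensive edge,
so that [Q * f c <= OPT] and [n] additional edges of cost at most [f c] are
affordable. A source [i < c] keeps its sinks below [Q]. Its other sinks are
exchanged for a block of consecutive larger sinks below [Q] which are kept by no
source [i' < c]. Starting each block at a fresh sink costs no additional edge at
[i], and only the last sink of the block remains partially unserved. The sources
[i >= c] then serve the residual demands, in index order, by the north-west
corner rule. Hence edges at sinks [>= Q] come from sources at least as cheap as
all those used at sinks [< Q], and a comparison of prefix sums shows that the first
[N] sources use at most [n] edges more than in the optimum (none more if
[N <= c]). Summation by parts turns this into the bound on the cost. *)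

Require Import Defs.
From HB Require Import structures.
From mathcomp Require Import all_boot all_order all_algebra.
From mathcomp Require Import reals.
From mathcomp Require Import zify.
Import Order.TTheory GRing.Theory Num.Theory.

Set Implicit Arguments.
Unset Strict Implicit.
Unset Printing Implicit Defensive.
Local Open Scope nat_scope.

(** * Interval overlaps, counting, and the north-west corner rule *)

(** The intervals from [S i] to [S i.+1] tile the one from [S 0] to [S c]; with truncated
    subtraction, [minn _ _ - maxn _ _] is the length of an intersection. *)
Lemma sum_overlap (S : nat -> nat) (u v c : nat) :
  (forall i, S i <= S i.+1) -> u <= v ->
  \sum_(0 <= i < c) (minn (S i.+1) v - maxn (S i) u) =
  minn (S c) v - maxn (S 0) u.
Proof.
move=> Smono le_uv; elim: c => [|c IH]; first by rewrite big_geq //; lia.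
have S0c : S 0 <= S c.
  by elim: (c) => // k /leq_trans; apply.
by rewrite big_nat_recr //= IH; have := Smono c; lia.
Qed.

Lemma sum_nat_le1 (F : nat -> bool) (a b : nat) :
  (forall i j, a <= i < b -> a <= j < b -> F i -> F j -> i = j) ->
  \sum_(a <= i < b) F i <= 1.
Proof.
elim: b => [|b IH] uF; first by rewrite big_geq.
have [le_ab|lt_ba] := leqP a b; last by rewrite big_geq.
rewrite big_nat_recr //=; case Fb: (F b).
  rewrite big_nat_cond big1 // => i; rewrite andbT => i_ab.
  by case Fi: (F i) => //; have := uF i b; rewrite Fi Fb; lia.
by rewrite addn0; apply: IH => i j i_ab j_ab; apply: uF; lia.
Qed.

Lemma sum_fiber (s b : nat -> nat) (P : pred nat) (m c : nat) :
  \sum_(0 <= i < c) \sum_(0 <= j < m | (s j == i) && P j) b j =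
  \sum_(0 <= j < m | (s j < c) && P j) b j.
Proof.
under eq_bigr do rewrite big_mkcond /=.
rewrite exchange_big /= [RHS]big_mkcond /=; apply: eq_bigr => j _.
case: (P j); last by rewrite andbF big1 // => i _; rewrite andbF.
under eq_bigr do rewrite andbT.
rewrite andbT -big_mkcond /=; under eq_bigl do rewrite eq_sym.
by rewrite big_nat1_eq.
Qed.

(** Exchange against [b t]: an index in [Z] only is below [t] and weighs at least [b t], one in [Y]
    only is at least [t] and weighs at most [b t]. So if [Y] had no more elements than [Z], it could
    not weigh more. *)
Lemma ltn_count_of_sum (b : nat -> nat) (Z Y : pred nat) (t m : nat) :
  (forall j j', j <= j' -> b j' <= b j) ->
  (forall j, Z j -> ~~ Y j -> j < t) -> (forall j, j < t -> Z j) ->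
  \sum_(0 <= j < m | Z j) b j < \sum_(0 <= j < m | Y j) b j ->
  \sum_(0 <= j < m) Z j < \sum_(0 <= j < m) Y j.
Proof.
move=> bmono ZYt tZ.
rewrite [X in X < _]big_mkcond [X in _ < X]big_mkcond /= => lt_b.
rewrite ltnNge; apply/negP => le_YZ; move: lt_b; rewrite ltnNge => /negP; apply.
have key : \sum_(0 <= j < m) ((if Y j then b j else 0) + Z j * b t) <=
           \sum_(0 <= j < m) ((if Z j then b j else 0) + Y j * b t).
  apply: leq_sum => j _.
  have [lt_jt|le_tj] := ltnP j t.
    rewrite (tZ _ lt_jt) mul1n; have := bmono _ _ (ltnW lt_jt).
    by case: (Y j); lia.
  have := bmono _ _ le_tj; have := ZYt j.
  by case: (Z j); case: (Y j); rewrite /= ?mul1n ?mul0n //; lia.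
move: key; rewrite !big_split /= -!big_distrl /=.
by have := leq_mul le_YZ (leqnn (b t)); lia.
Qed.

(* Every edge of the north-west corner rule exhausts its source or its sink. *)
Lemma sum_staircase (A C : nat -> nat) (m N c : nat) :
  (forall i, A i <= A i.+1) -> (forall j, C j <= C j.+1) -> c <= N ->
  \sum_(c <= i < N) \sum_(0 <= j < m)
      (0 < minn (A i.+1) (C j.+1) - maxn (A i) (C j)) <=
  (N - c) + \sum_(0 <= j < m) ((C j < C j.+1) && (C j < A N)).
Proof.
move=> Am Cm le_cN.
have Amono i i' : i <= i' -> A i <= A i' by apply: (homo_leq leqnn leq_trans Am).
have Cmono j j' : j <= j' -> C j <= C j' by apply: (homo_leq leqnn leq_trans Cm).
pose F i j := (0 < minn (A i.+1) (C j.+1) - maxn (A i) (C j)).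
(* [G] collects the edges that exhaust their source, at most one per source; [H] those that exhaust
   only their sink, at most one per sink. *)
pose G i j := F i j && (A i.+1 <= C j.+1).
pose H i j := F i j && (C j.+1 < A i.+1).
have -> : \sum_(c <= i < N) \sum_(0 <= j < m) F i j =
    \sum_(c <= i < N) \sum_(0 <= j < m) G i j +
    \sum_(0 <= j < m) \sum_(c <= i < N) H i j.
  rewrite [X in _ + X]exchange_big -big_split; apply: eq_bigr => i _.
  rewrite -big_split; apply: eq_bigr => j _ /=; rewrite /G /H.
  by case: (F i j); lia.
apply: leq_add.
  rewrite -[N - c]muln1 -sum_nat_const_nat; apply: leq_sum => i _.
  apply: sum_nat_le1 => j j' _ _; rewrite /G /F.
  have := Cmono j.+1 j'; have := Cmono j'.+1 j.
  by lia.
apply: leq_sum => j _.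
have [->|/eqP nz] := eqVneq (\sum_(c <= i < N) H i j) 0; first by [].
have : \sum_(c <= i < N) H i j <= 1.
  apply: sum_nat_le1 => i i' _ _; rewrite /H /F.
  have := Amono i.+1 i'; have := Amono i'.+1 i.
  by lia.
suff -> : (C j < C j.+1) && (C j < A N) by [].
apply/negP => neg; apply: nz; rewrite big_nat_cond big1 // => i.
rewrite andbT => i_cN; have := Amono i.+1 N; rewrite /H /F.
by move: neg => /negP; lia.
Qed.

Lemma leq_sum_widen (b : nat -> nat) (j j' : nat) :
  j <= j' -> \sum_(0 <= l < j) b l <= \sum_(0 <= l < j') b l.
Proof.
by move=> le_jj'; rewrite [leqRHS](big_cat_nat _ le_jj') //= leq_addr.
Qed.

Lemma sum_disjoint_overlap (S E : nat -> nat) (u v c : nat) :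
  (forall i, i < c -> S i <= E i <= S i.+1) -> u <= v ->
  \sum_(0 <= i < c) (minn (E i) v - maxn (S i) u) <= v - u.
Proof.
move=> SE le_uv.
have {SE} : forall i, i < c -> E i <= S i.+1 /\ S i <= S i.+1.
  by move=> i /SE; lia.
(* This sharper bound is the one that passes through the induction. *)
suff : (forall i, i < c -> E i <= S i.+1 /\ S i <= S i.+1) ->
  \sum_(0 <= i < c) (minn (E i) v - maxn (S i) u) <= minn (S c) v - maxn (S 0) u.
  by move=> H /H /leq_trans; apply; lia.
elim: c => [|c IH] SE; first by rewrite big_geq.
rewrite big_nat_recr //=.
have S0c : S 0 <= S c.
  have : forall i, i < c -> S i <= S i.+1 by move=> i lt_ic; have := SE i; lia.
  elim: (c) => // k IHk H; apply: leq_trans (H k _) => //.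
  by apply: IHk => i lt_ik; apply: H; lia.
have := SE c (ltnSn c); have := IH (fun i H => SE i (leqW H)).
by lia.
Qed.

(** * The rounding, in natural numbers *)

Section Rounding.

Variables (n m Q c : nat) (b s : nat -> nat).

Let a i := \sum_(0 <= j < m | s j == i) b j.
Let d i := \sum_(0 <= j < m) (s j == i).

Hypothesis b_mono : forall j j', j <= j' -> b j' <= b j.
Hypothesis s_lt : forall j, j < m -> s j < n.
Hypothesis lt_cn : c < n.
Hypothesis lt_Qm : Q < m.
Hypothesis D_le : \sum_(0 <= i < c) d i <= Q.

(* [K]: kept sinks. [b1], [B], [cnt]: demands, their prefix sums and prefix
   counts, over the sinks not kept. [r i], [o i]: total demand and number of the
   sinks [>= Q] of source [i]. *)
Let K j := (j < Q) && (s j < c).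
Let b1 j := if K j then 0 else b j.
Let B j := \sum_(0 <= l < j) b1 l.
Let cnt j := \sum_(0 <= l < j) ~~ K l.
Let r i := \sum_(0 <= j < m | (s j == i) && (Q <= j)) b j.
Let o i := \sum_(0 <= j < m) ((s j == i) && (Q <= j)).

(* Source [i] receives the sinks not in [K] from [block_start i] to
   [block_start i.+1] (excluded). *)
Fixpoint block_start i :=
  if i is i'.+1 then
    let p := block_start i' in
    find (fun j => (p <= j) && (B p + r i' <= B j)) (iota 0 m)
  else 0.
Arguments block_start : simpl never.
Let p := block_start.

(* With demands laid out as consecutive intervals, [y] and [z] are lengths of
   intersections: [y] for the blocks, [z] for the north-west corner rule, which
   distributes the demands [b2] left over by the blocks. *)
Let y i j := minn (B (p i) + r i) (B j.+1) - maxn (B (p i)) (B j).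
Let b2 j := b1 j - \sum_(0 <= i < c) y i j.
Let C j := \sum_(0 <= l < j) b2 l.
Let A i := \sum_(c <= l < i) a l.
Let z i j := minn (A i.+1) (C j.+1) - maxn (A i) (C j).
Let x i j :=
  if i < c then (if (s j == i) && (j < Q) then b j else 0) + y i j else z i j.

Let nK := \sum_(0 <= j < m) K j.

Lemma free_sum_mono j j' : j <= j' -> B j <= B j'.
Proof. exact: leq_sum_widen. Qed.

Lemma free_count_mono j j' : j <= j' -> cnt j <= cnt j'.
Proof. exact: leq_sum_widen. Qed.

Lemma free_sumS j : B j.+1 = B j + b1 j.
Proof. by rewrite /B big_nat_recr. Qed.

Lemma free_countS j : cnt j.+1 = cnt j + ~~ K j.
Proof. by rewrite /cnt big_nat_recr. Qed.

Lemma outside_sum_le i : r i <= o i * b Q.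
Proof.
rewrite /r /o big_mkcond big_distrl /=; apply: leq_sum => j _.
by case: (_ == _) => //=; case: (leqP Q j) => //= /b_mono; rewrite mul1n.
Qed.

(** Demands below [Q] are at least [b Q], those from [Q] on at most [b Q] ([outside_sum_le]); this
    common yardstick turns amounts of demand into numbers of sinks. *)
Lemma free_sum_ge_count j j' : j <= j' -> j' <= Q ->
  (cnt j' - cnt j) * b Q <= B j' - B j.
Proof.
move=> le_jj'; rewrite -(subnKC le_jj'); elim: (j' - j) => [|k IH] le_Q.
  by rewrite addn0 !subnn.
rewrite addnS free_sumS free_countS.
have /IH {}IH : j + k <= Q by lia.
have := @free_count_mono j (j + k); have := @free_sum_mono j (j + k).
have : b Q <= b (j + k) by apply: b_mono; lia.
rewrite /b1; case: (K (j + k)); nia.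
Qed.

Lemma sum_outside_count k :
  \sum_(0 <= i < k) o i = \sum_(0 <= j < m) ((s j < k) && (Q <= j)).
Proof.
have := @sum_fiber s (fun=> 1) (fun j => Q <= j) m k.
rewrite [RHS]big_mkcond /= => <-; apply: eq_bigr => i _.
rewrite /o [RHS]big_mkcond /=; apply: eq_bigr => j _.
by case: (_ && _).
Qed.

Lemma sum_degree k : \sum_(0 <= i < k) d i = \sum_(0 <= j < m) (s j < k).
Proof.
have := @sum_fiber s (fun=> 1) (fun j => true) m k.
rewrite [RHS]big_mkcond /= => E.
transitivity (\sum_(0 <= j < m) if (s j < k) && true then 1 else 0); last first.
  by apply: eq_bigr => j _; rewrite andbT; case: (_ < _).
rewrite -E; apply: eq_bigr => i _.
rewrite /d [RHS]big_mkcond /=; apply: eq_bigr => j _.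
by rewrite andbT; case: (_ == _).
Qed.

Lemma kept_count_outside : nK + \sum_(0 <= i < c) o i = \sum_(0 <= i < c) d i.
Proof.
rewrite sum_outside_count sum_degree /nK -big_split /=.
apply: eq_bigr => j _; rewrite /K.
by case: (s j < c); rewrite ?andbF //= andbT; case: ltnP.
Qed.

Lemma kept_count_free j : Q <= j -> j <= m -> nK + cnt j = j.
Proof.
move=> leQj lejm; rewrite /nK (big_cat_nat _ lejm) //=.
rewrite [X in _ + X + _]big_nat_cond [X in _ + X + _]big1 ?addn0; last first.
  by move=> l; rewrite /K; case: ltnP => //=; lia.
rewrite /cnt -big_split /=; under eq_bigr => l _ do rewrite addnC addn_negb.
by rewrite sum_nat_const_nat muln1 subn0.
Qed.

(** * Existence and size of the blocks *)

(** The [o k] sinks given up weigh at most [b Q] each, free sinks below [Q] at least [b Q] each, so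
    equally many free sinks suffice as replacement. *)
Lemma block_step k : k < c -> p k <= Q -> cnt (p k) <= \sum_(0 <= i < k) o i ->
  [/\ p k <= p k.+1 <= Q, B (p k) + r k <= B (p k.+1),
      forall j, p k <= j < p k.+1 -> B j < B (p k) + r k &
      cnt (p k.+1) <= cnt (p k) + o k].
Proof.
move=> lt_kc le_pQ cnt_p.
(* By [D_le], [nK] and all the [o i] add up to at most [Q]. The earlier blocks took at most their
   share, so [o k] free sinks remain below [Q], and the search in [block_start] succeeds. *)
have BQ : B (p k) + r k <= B Q.
  have : o k <= cnt Q - cnt (p k).
    have := kept_count_free (leqnn Q) (ltnW lt_Qm); have := kept_count_outside.
    have : \sum_(0 <= i < k.+1) o i <= \sum_(0 <= i < c) o i.
      exact: leq_sum_widen.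
    by rewrite big_nat_recr //=; lia.
  move=> /(leq_mul)/(_ (leqnn (b Q))).
  have := free_sum_ge_count le_pQ (leqnn Q); have := outside_sum_le k.
  by have := free_sum_mono le_pQ; lia.
set P := fun j => (p k <= j) && (B (p k) + r k <= B j).
have Ep : p k.+1 = find P (iota 0 m) by [].
have hasP : has P (iota 0 m).
  by apply/hasP; exists Q; rewrite ?mem_iota /P ?le_pQ.
have lt_pm : p k.+1 < m by rewrite Ep -[X in _ < X](size_iota 0 m) -has_find.
have := nth_find 0 hasP; rewrite -Ep nth_iota // add0n => /andP[le_pp Bp].
have minp j : j < p k.+1 -> ~~ P j.
  move=> lt_jp; have := @before_find _ 0 P (iota 0 m) j.
  by rewrite -Ep nth_iota ?add0n => [->//|]; lia.
have Bj j : p k <= j < p k.+1 -> B j < B (p k) + r k.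
  by case/andP=> le_pj /minp; rewrite /P le_pj /= -ltnNge.
have le_p1Q : p k.+1 <= Q.
  by rewrite leqNgt; apply/negP => /minp; rewrite /P le_pQ BQ.
split=> //; first by rewrite le_pp.
have [->|lt_pp] := eqVneq (p k.+1) (p k); first exact: leq_addr.
(* [l] is the last sink of a nonempty block; those before it hold less than [r k], hence fewer than
   [o k] of them are free. *)
have [l El] : exists l, p k.+1 = l.+1 by exists (p k.+1).-1; lia.
have /Bj Bl : p k <= l < p k.+1 by lia.
have le_pl : p k <= l by lia.
have := free_sum_ge_count le_pl; have := outside_sum_le k.
have := free_sum_mono le_pl; have := free_count_mono le_pl.
rewrite El free_countS => H1 H2 H3 /(_ _) H4.
have /H4 {}H4 : l <= Q by lia.
suff : cnt l - cnt (p k) < o k by lia.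
have : (cnt l - cnt (p k)) * b Q < o k * b Q by lia.
by rewrite ltn_mul2r => /andP[].
Qed.

Lemma block_inv k : k <= c -> p k <= Q /\ cnt (p k) <= \sum_(0 <= i < k) o i.
Proof.
elim: k => [|k IH] lt_kc; first by rewrite /cnt big_geq.
have [pQ cp] := IH (ltnW lt_kc); have [] := block_step lt_kc pQ cp.
by move=> /andP[_ ->] _ _; rewrite big_nat_recr //=; lia.
Qed.

Lemma block_spec k : k < c ->
  [/\ p k <= p k.+1 <= Q, B (p k) + r k <= B (p k.+1),
      forall j, p k <= j < p k.+1 -> B j < B (p k) + r k &
      cnt (p k.+1) <= cnt (p k) + o k].
Proof. by move=> lt_kc; have [] := block_inv (ltnW lt_kc); apply: block_step. Qed.

Lemma block_row_sum i : i < c -> \sum_(0 <= j < m) y i j = r i.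
Proof.
move=> lt_ic; have [/andP[_ pQ] Bp _ _] := block_spec lt_ic.
have := @sum_overlap B (B (p i)) (B (p i) + r i) m.
rewrite /y => /(_ (fun j => free_sum_mono (leqnSn j)) (leq_addr _ _)) E.
under eq_bigr do rewrite minnC maxnC.
rewrite E; have : B (p i.+1) <= B m by apply: free_sum_mono; lia.
have : B 0 = 0 by rewrite /B big_geq.
by lia.
Qed.

Lemma block_col_sum j : \sum_(0 <= i < c) y i j <= b1 j.
Proof.
rewrite -[b1 j](addKn (B j)) -free_sumS.
apply: (@sum_disjoint_overlap (fun i => B (p i)) (fun i => B (p i) + r i)).
  by move=> i /block_spec[_ -> _ _]; rewrite leq_addr.
exact: free_sum_mono.
Qed.

Lemma block_support i j : i < c -> 0 < y i j -> (p i <= j < p i.+1) && ~~ K j.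
Proof.
move=> lt_ic; rewrite /y => y0; have [_ Bp _ _] := block_spec lt_ic.
apply/andP; split; last first.
  by apply: contraL y0 => Kj; have := free_sumS j; rewrite /b1 Kj; lia.
by have := @free_sum_mono j.+1 (p i); have := @free_sum_mono (p i.+1) j; lia.
Qed.

Lemma block_degree i : i < c ->
  \sum_(0 <= j < m) (0 < y i j) <= cnt (p i.+1) - cnt (p i).
Proof.
move=> lt_ic; have [/andP[pp pQ] _ _ _] := block_spec lt_ic.
have -> : cnt (p i.+1) - cnt (p i) = \sum_(p i <= j < p i.+1) ~~ K j.
  by rewrite {1}/cnt (big_cat_nat _ pp) //= addKn.
rewrite (big_cat_nat (leq0n (p i))) /=; last by lia.
rewrite [X in X + _]big_nat_cond [X in X + _]big1 ?add0n; last first.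
  move=> j; rewrite andbT => jp; case y0: (0 < y i j) => //.
  by exfalso; have /andP[? _] := block_support lt_ic y0; lia.
rewrite (big_cat_nat pp) /=; last by lia.
rewrite [X in _ + X]big_nat_cond [X in _ + X]big1 ?addn0; last first.
  move=> j; rewrite andbT => jp; case y0: (0 < y i j) => //.
  by exfalso; have /andP[? _] := block_support lt_ic y0; lia.
apply: leq_sum => j _; case y0: (0 < y i j) => //.
by have /andP[_ ->] := block_support lt_ic y0.
Qed.

Lemma residual_count k : k <= c -> \sum_(0 <= j < p k) (0 < b2 j) <= k.
Proof.
elim: k => [|k IH] lt_kc; first by rewrite big_geq.
have [/andP[pp pQ] _ Bj _] := block_spec lt_kc.
rewrite (big_cat_nat _ pp) //= -[leqRHS]addn1.
apply: leq_add; first exact: IH (ltnW lt_kc).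
apply: sum_nat_le1 => i j.
(* Only the last sink of a block keeps residual demand: for any other [l] the interval of [l] lies
   inside that of block [k], so [y k l] is all of [b1 l]. *)
suff key l : p k <= l < p k.+1 -> 0 < b2 l -> p k.+1 = l.+1.
  by move=> /key H1 /key H2 /H1 H3 /H2; lia.
move=> lp; have [//|neq] := eqVneq (p k.+1) l.+1.
have /Bj Bl : p k <= l.+1 < p k.+1 by lia.
have : y k l <= \sum_(0 <= i < c) y i l.
  by rewrite (bigD1_seq k) ?mem_index_iota ?iota_uniq //= leq_addr.
have : B (p k) <= B l by apply: free_sum_mono; lia.
have := free_sumS l.
by rewrite /b2 {1}/y; lia.
Qed.

(** * Balance of supply and demand, and feasibility *)

Lemma sum_supply k : \sum_(0 <= i < k) a i = \sum_(0 <= j < m | s j < k) b j.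
Proof.
have := @sum_fiber s b xpredT m k.
under [X in _ = X -> _]eq_bigl do rewrite andbT.
by move=> <-; apply: eq_bigr => i _; apply: eq_bigl => j; rewrite andbT.
Qed.

Let bK := \sum_(0 <= j < m | K j) b j.

Lemma kept_sum_outside : bK + \sum_(0 <= i < c) r i = \sum_(0 <= i < c) a i.
Proof.
rewrite sum_supply sum_fiber [RHS](bigID (fun j => j < Q)) /=.
congr (_ + _); apply: eq_bigl => j; first by rewrite andbC.
by rewrite -leqNgt.
Qed.

Lemma kept_sum_free : bK + B m = \sum_(0 <= i < n) a i.
Proof.
rewrite sum_supply /bK /B big_mkcond -big_split /= [RHS]big_mkcond /=.
apply: eq_big_nat => j /andP[_ /s_lt ->]; rewrite /b1.
by case: (K j); rewrite ?addn0.
Qed.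

Lemma residual_sumS j : C j.+1 = C j + b2 j.
Proof. by rewrite /C big_nat_recr. Qed.

Lemma residual_sum_mono j j' : j <= j' -> C j <= C j'.
Proof. exact: leq_sum_widen. Qed.

Lemma cheap_supply_cat i i' : c <= i -> i <= i' ->
  A i' = A i + \sum_(i <= l < i') a l.
Proof. by move=> le_ci le_ii'; rewrite /A (big_cat_nat le_ci). Qed.

Lemma cheap_supply_mono i i' : i <= i' -> A i <= A i'.
Proof.
move=> le_ii'; have [le_ci|lt_ic] := leqP c i.
  by rewrite (cheap_supply_cat le_ci le_ii') leq_addr.
by rewrite {1}/A big_geq // ltnW.
Qed.

Lemma sum_supply_cheap k : c <= k ->
  \sum_(0 <= i < k) a i = \sum_(0 <= i < c) a i + A k.
Proof. by move=> le_ck; rewrite (big_cat_nat _ le_ck). Qed.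

Lemma free_sum_residual t :
  B t = C t + \sum_(0 <= i < c) \sum_(0 <= j < t) y i j.
Proof.
rewrite exchange_big /B /C -big_split /=; apply: eq_bigr => j _.
by rewrite /b2 subnK // block_col_sum.
Qed.

Lemma free_sum_residual_le t : t <= m -> B t <= C t + \sum_(0 <= i < c) r i.
Proof.
move=> le_tm; rewrite free_sum_residual leq_add2l !big_nat.
apply: leq_sum => i /andP[_ lt_ic].
by rewrite -block_row_sum //; apply: leq_sum_widen.
Qed.

(** Residual demand and cheap supply agree in total, so the north-west corner rule uses up both. *)
Lemma residual_sum_total : C m = A n.
Proof.
have := kept_sum_free.
rewrite sum_supply_cheap ?(ltnW lt_cn) // -kept_sum_outside free_sum_residual.
by rewrite (eq_big_nat _ _ (fun i H => block_row_sum (proj2 (andP H)))); lia.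
Qed.

Lemma rounding_row i : i < n -> \sum_(0 <= j < m) x i j = a i.
Proof.
move=> lt_in; rewrite /x; have [lt_ic|le_ci] := ltnP.
  rewrite big_split /= block_row_sum // -big_mkcond /= [RHS](bigID (fun j => j < Q)) /=.
  by congr (_ + _); apply: eq_bigl => j; rewrite -leqNgt.
rewrite /z; under eq_bigr do rewrite minnC maxnC.
rewrite (sum_overlap _ (fun j => residual_sum_mono (leqnSn j))
  (cheap_supply_mono (leqnSn i))).
have := residual_sum_total; have := cheap_supply_mono lt_in.
have := cheap_supply_cat le_ci (leqnSn i).
rewrite big_nat1; have : C 0 = 0 by rewrite /C big_geq.
by lia.
Qed.

Lemma rounding_col j : j < m -> \sum_(0 <= i < n) x i j = b j.
Proof.
move=> lt_jm; rewrite (big_cat_nat _ (ltnW lt_cn)) //=.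
have -> : \sum_(c <= i < n) x i j = b2 j.
  (* [z] vanishes for [i < c], where [A i.+1] is an empty sum, so the overlaps can be summed over
     all [i < n]. *)
  have : \sum_(0 <= i < n) z i j = b2 j.
    rewrite (sum_overlap _ (fun i => cheap_supply_mono (leqnSn i))
      (residual_sum_mono (leqnSn j))).
    have : C j.+1 <= A n by rewrite -residual_sum_total residual_sum_mono.
    have : A 0 = 0 by rewrite /A big_geq.
    by have := residual_sumS j; lia.
  rewrite (big_cat_nat _ (ltnW lt_cn)) //= big_nat.
  rewrite big1 ?add0n => [<-|i /andP[_ lt_ic]].
    by apply: eq_big_nat => i /andP[le_ci _]; rewrite /x ltnNge le_ci.
  by rewrite /z {1}/A big_geq // min0n sub0n.
have -> : \sum_(0 <= i < c) x i j =
    (if K j then b j else 0) + \sum_(0 <= i < c) y i j.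
  rewrite -[X in X + _]/(if (j < Q) && (s j < c) then b j else 0).
  under eq_big_nat => i /andP[_ lt_ic] do rewrite /x lt_ic.
  rewrite big_split /=; congr (_ + _); rewrite -big_mkcond /=.
  case: (j < Q) => /=; last by rewrite big_pred0 // => i; rewrite andbF.
  under eq_bigl do rewrite andbT eq_sym.
  by rewrite big_nat1_eq.
have := block_col_sum j; rewrite /b2 /b1; case: (K j); lia.
Qed.

(** * Separation at sink [Q], and numbers of edges *)

Lemma rounding_expensive_support i j : i < c -> 0 < x i j -> j < Q.
Proof.
move=> lt_ic; rewrite /x lt_ic; case: (ltnP j Q) => // le_Qj; rewrite andbF add0n.
move=> /(block_support lt_ic) /andP[/andP[_ lt_jp] _].
by have [/andP[_ pQ] _ _ _] := block_spec lt_ic; lia.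
Qed.

(** Sources below [c] never reach a sink from [Q] on, and among the other sources the north-west
    corner rule serves later sinks from sources that come no earlier. *)
Lemma rounding_separated i i' j j' :
  j < Q -> Q <= j' -> 0 < x i j -> 0 < x i' j' -> i <= i'.
Proof.
move=> lt_jQ le_Qj' xij xij'; have [lt_ic'|le_ci'] := ltnP i' c.
  by have := rounding_expensive_support lt_ic' xij'; lia.
have [/ltnW/leq_trans|le_ci] := ltnP i c; first exact.
move: xij xij'; rewrite /x !ltnNge le_ci le_ci' /= -!ltnNge /z => zij zij'.
rewrite leqNgt; apply/negP => lt_i'i.
by have := cheap_supply_mono lt_i'i; have := @residual_sum_mono j.+1 j'; lia.
Qed.

Lemma rounding_degree_le i : i < c ->
  \sum_(0 <= j < m) (0 < x i j) <=
  \sum_(0 <= j < m) ((s j == i) && (j < Q)) + (cnt (p i.+1) - cnt (p i)).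
Proof.
move=> lt_ic; apply: leq_trans (_ : \sum_(0 <= j < m) ((s j == i) && (j < Q)) +
  \sum_(0 <= j < m) (0 < y i j) <= _); last by rewrite leq_add2l block_degree.
rewrite -big_split /=; apply: leq_sum => j _; rewrite /x lt_ic.
by case: (_ && _) => //; case: (0 < _).
Qed.

Lemma rounding_degree i : i < c -> \sum_(0 <= j < m) (0 < x i j) <= d i.
Proof.
move=> lt_ic; apply: leq_trans (rounding_degree_le lt_ic) _.
have [_ _ _ le_o] := block_spec lt_ic.
have -> : d i = \sum_(0 <= j < m) ((s j == i) && (j < Q)) + o i.
  rewrite /d /o -big_split /=; apply: eq_bigr => j _.
  by case: (s j == i) => //=; case: ltnP.
by rewrite leq_add2l; lia.
Qed.

Lemma rounding_degree_expensive k : k <= c ->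
  \sum_(0 <= i < k) \sum_(0 <= j < m) (0 < x i j) <=
  \sum_(0 <= j < m) ((s j < k) && (j < Q)) + cnt (p k).
Proof.
elim: k => [|k IH] lt_kc; first by rewrite big_geq.
rewrite big_nat_recr //=; have := rounding_degree_le lt_kc; have := IH (ltnW lt_kc).
have [/andP[/free_count_mono le_cnt _] _ _ _] := block_spec lt_kc.
have -> : \sum_(0 <= j < m) ((s j < k.+1) && (j < Q)) =
  \sum_(0 <= j < m) ((s j < k) && (j < Q)) +
  \sum_(0 <= j < m) ((s j == k) && (j < Q)).
  rewrite -big_split /=; apply: eq_bigr => j _.
  by case: (j < Q); rewrite ?andbF // !andbT ltnS leq_eqVlt; case: ltngtP.
by lia.
Qed.

(* [Z] below has total demand less than the supply of the first [N] sources
   since [t] is still touched, and among the sinks not in [K] it has the largest. *)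
Lemma consumed_count N t : c <= N -> t < m -> C t < A N ->
  nK + cnt t < \sum_(0 <= i < N) d i.
Proof.
move=> le_cN lt_tm lt_CA; pose Z j := (j < t) || K j.
have E (F : nat -> nat) :
    \sum_(0 <= j < t) F j = \sum_(0 <= j < m) if j < t then F j else 0.
  by rewrite (big_nat_widen _ _ _ _ _ (ltnW lt_tm)) big_mkcond.
have -> : nK + cnt t = \sum_(0 <= j < m) Z j.
  rewrite /nK /cnt E -big_split /=; apply: eq_bigr => j _; rewrite /Z.
  by case: (j < t); case: (K j).
rewrite sum_degree; apply: (@ltn_count_of_sum b Z (fun j => s j < N) t m b_mono).
- move=> j /orP[//|/andP[_ lt_sc]]; have : s j < N by lia.
  by move=> ->.
- by move=> j; rewrite /Z => ->.
rewrite -sum_supply sum_supply_cheap // -kept_sum_outside.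
have -> : \sum_(0 <= j < m | Z j) b j = bK + B t.
  rewrite big_mkcond /bK [X in X + _]big_mkcond /B E -big_split /=.
  apply: eq_bigr => j _; rewrite /Z /b1.
  by case: (j < t); case: (K j); rewrite ?addn0.
by have := free_sum_residual_le (ltnW lt_tm); lia.
Qed.

(** The excess [N] consists of [N - c] for exhausted cheap sources and [c] for the partially served
    last sinks of blocks. All other edges are charged to distinct sinks, either kept or free. *)
Lemma rounding_degree_prefix N : c < N ->
  \sum_(0 <= i < N) \sum_(0 <= j < m) (0 < x i j) <= \sum_(0 <= i < N) d i + N.
Proof.
move=> lt_cN; have le_cN := ltnW lt_cN.
have [le_pQ le_o] := block_inv (leqnn c).
(* [T j]: sink [j] has residual demand and is touched by a cheap source among the first [N]. *)
pose T j := (C j < C j.+1) && (C j < A N).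
have Tb j : T j -> 0 < b2 j by rewrite /T residual_sumS; lia.
have TK j : T j -> ~~ K j.
  by move/Tb; apply: contraL => Kj; rewrite /b2 /b1 Kj.
have cheap : \sum_(c <= i < N) \sum_(0 <= j < m) (0 < x i j) <=
    (N - c) + \sum_(0 <= j < m) T j.
  have := sum_staircase m (fun i => cheap_supply_mono (leqnSn i))
    (fun j => residual_sum_mono (leqnSn j)) le_cN.
  apply: leq_trans; rewrite !big_nat; apply: leq_sum => i /andP[le_ci _].
  by rewrite /x ltnNge le_ci.
have expn := rounding_degree_expensive (leqnn c).
have EK : \sum_(0 <= j < m) ((s j < c) && (j < Q)) = nK.
  by apply: eq_bigr => j _; rewrite andbC.
rewrite {}EK in expn.
have le_pm : p c <= m by lia.
have Tp : \sum_(0 <= j < p c) T j <= c.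
  apply: leq_trans (residual_count (leqnn c)); apply: leq_sum => j _.
  by have := Tb j; case: (T j) => // ->.
rewrite (big_cat_nat _ le_cN) //=.
rewrite (big_cat_nat _ le_pm) //= in cheap.
have dN : \sum_(0 <= i < c) d i <= \sum_(0 <= i < N) d i by apply: leq_sum_widen.
have oK := kept_count_outside.
suff : nK + cnt (p c) + \sum_(p c <= j < m) T j <= \sum_(0 <= i < N) d i by lia.
case: (boolP (has T (index_iota (p c) m)));
  [move=> /hasP[t0 t0_in Tt0] | move=> /hasPn noT]; last first.
  rewrite [X in _ + X]big_nat_cond [X in _ + X]big1 ?addn0; first by lia.
  by move=> j; rewrite andbT -mem_index_iota => /noT/negPf->.
have exT : exists t, (p c <= t < m) && T t.
  by exists t0; rewrite -mem_index_iota t0_in.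
have ubT t : (p c <= t < m) && T t -> t <= m by lia.
(* [t] is the last touched sink, so the touched sinks from [p c] on are free sinks up to [t], and
   [consumed_count] applies. *)
case: (ex_maxnP exT ubT) => t /andP[/andP[le_pt lt_tm] Tt] tmax.
have := consumed_count le_cN lt_tm (proj2 (andP Tt)).
suff : \sum_(p c <= j < m) T j <= cnt t.+1 - cnt (p c).
  by have := free_count_mono le_pt; rewrite free_countS; case: (K t); lia.
rewrite {1}/cnt (big_cat_nat _ (leqW le_pt)) //= addKn.
rewrite (big_cat_nat (leqW le_pt) lt_tm) /=.
rewrite [X in _ + X]big_nat_cond [X in _ + X]big1 ?addn0 => [|j].
  by apply: leq_sum => j _; have := TK j; case: (T j) => // ->.
rewrite andbT => j_tm; case Tj: (T j) => //.
by have := tmax j; rewrite Tj; lia.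
Qed.

Lemma rounding : exists x : nat -> nat -> nat,
  [/\ forall i, i < n ->
        \sum_(0 <= j < m) x i j = \sum_(0 <= j < m | s j == i) b j,
      forall j, j < m -> \sum_(0 <= i < n) x i j = b j,
      forall i i' j j', j < Q -> Q <= j' -> 0 < x i j -> 0 < x i' j' -> i <= i',
      forall i, i < c ->
        \sum_(0 <= j < m) (0 < x i j) <= \sum_(0 <= j < m) (s j == i) &
      forall N, c < N -> \sum_(0 <= i < N) \sum_(0 <= j < m) (0 < x i j) <=
        \sum_(0 <= i < N) \sum_(0 <= j < m) (s j == i) + N].
Proof.
exists x; split; [exact: rounding_row | exact: rounding_col |
  exact: rounding_separated | exact: rounding_degree |
  exact: rounding_degree_prefix].
Qed.

End Rounding.

Local Open Scope ring_scope.

(** * From numbers of edges to costs, and choice of the top edges *)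

Lemma ler_sum_prefix (R : numDomainType) (f : nat -> R)
    (u v : nat -> nat) (n : nat) :
  (forall i, 0 <= f i) -> (forall i, f i.+1 <= f i) ->
  (forall k, (k <= n)%N ->
    (\sum_(0 <= i < k) u i <= \sum_(0 <= i < k) v i)%N) ->
  \sum_(0 <= i < n) f i * (u i)%:R <= \sum_(0 <= i < n) f i * (v i)%:R.
Proof.
move=> f0 fmono le_uv.
(* Summation by parts: the induction carries the slack of the prefix sums at price [f n], which only
   falls. The truncated difference is exact by [le_uv]. *)
suff : \sum_(0 <= i < n) f i * (u i)%:R +
    f n * (\sum_(0 <= i < n) v i - \sum_(0 <= i < n) u i)%:R <=
    \sum_(0 <= i < n) f i * (v i)%:R.
  by apply: le_trans; rewrite lerDl mulr_ge0.
elim: n le_uv => [|n IH] le_uv; first by rewrite !big_geq // mulr0 addr0.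
have := IH (fun k H => le_uv k (leqW H)).
have := le_uv n.+1 (leqnn _); have := le_uv n (leqnSn _).
rewrite !(@big_nat_recr _ _ _ n) //=.
set U := (\sum_(0 <= i < n) u i)%N; set V := (\sum_(0 <= i < n) v i)%N.
move=> leUV leUV' IHn; rewrite -addrA.
apply: le_trans (lerD IHn (lexx (f n * (v n)%:R))).
rewrite -addrA lerD2l -mulrDr -natrD.
have -> : (V - U + v n = u n + (V + v n - (U + u n)))%N by lia.
by rewrite natrD mulrDr lerD2l ler_wpM2r.
Qed.

Lemma most_expensive_subset (R : realType) (n m : nat) (P : PFCTS R n m)
    (k : nat) (A B : {set 'I_n * 'I_m}) :
  B \subset A ->
  (forall e e', e \in B -> e' \in A :\: B -> edge_cost P e' <= edge_cost P e) ->
  (minn k #|A| <= #|B|)%N ->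
  exists2 E : {set 'I_n * 'I_m}, E \subset B & most_expensive P k A E.
Proof.
move=> sBA cB; move El: (minn k #|A|) => l le_lB.
suff [E [sEB cardE cE]] : exists E : {set 'I_n * 'I_m},
    [/\ E \subset B, #|E| = l &
    forall e e', e \in E -> e' \in A :\: E -> edge_cost P e' <= edge_cost P e].
  by exists E => //; split=> //; [apply: subset_trans sBA | rewrite cardE El].
elim: l le_lB {El} => [|l IH] lt_lB.
  exists set0; rewrite sub0set cards0; split=> // e e'.
  by rewrite inE.
have [E [sEB cardE cE]] := IH (ltnW lt_lB).
have /card_gt0P[e0 e0_in] : (0 < #|B :\: E|)%N.
  by rewrite cardsD (setIidPr sEB) cardE subn_gt0.
case: (@Order.TotalTheory.arg_maxP _ _ _ e0 (mem (B :\: E)) (edge_cost P) e0_in).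
move=> e /setDP[eB eE] emax; exists (e |: E); split.
- by rewrite subUset sub1set eB.
- by rewrite cardsU1 eE cardE.
move=> e1 e2 /setU1P[->|e1E]; rewrite !inE negb_or => /andP[/andP[_ e2E] e2A].
  have [e2B|e2B] := boolP (e2 \in B).
    by apply/emax/setDP.
  by apply: cB; rewrite // inE e2B.
by apply: cE; rewrite // inE e2E.
Qed.

Lemma cost_nat_mx (R : realType) (n m : nat) (P : PFCTS R n m)
    (X : nat -> nat -> nat) (f : nat -> R) :
  (forall i : 'I_n, f i = fixed_cost P i) ->
  cost P (\matrix_(i, j) (X i j)%:R) =
  \sum_(0 <= i < n) f i * (\sum_(0 <= j < m) (0 < X i j))%N%:R.
Proof.
move=> fE; rewrite /cost big_mkord; apply: eq_bigr => i _.
rewrite big_mkord natr_sum mulr_sumr; apply: eq_bigr => j _.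
by rewrite mxE ltr0n fE; case: (0 < X i j)%N; rewrite ?mulr1 ?mulr0.
Qed.

(** With [d i] edges at source [i], listed by source, the least [c] that works is the source of the
    [Q]-th edge. *)
Lemma exists_threshold (d : nat -> nat) (n Q : nat) : (0 < n)%N ->
  (Q <= \sum_(0 <= i < n) d i)%N ->
  exists c, [/\ (c < n)%N, (\sum_(0 <= i < c) d i <= Q)%N
    & (Q <= \sum_(0 <= i < c.+1) d i)%N].
Proof.
case: n => // n _ leQ.
have exc : exists c, (Q <= \sum_(0 <= i < c.+1) d i)%N by exists n.
case: (ex_minnP exc) => c leQc cmin; exists c; split=> //.
  by rewrite ltnS cmin.
case: c {leQc} cmin => [|c] cmin; first by rewrite big_geq.
rewrite leqNgt; apply/negP => /ltnW /cmin.
by rewrite ltnn.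
Qed.

(** * Transfer to the instance and conclusion *)

Lemma rounded_solution (R : realType) (n m q : nat) (P : PFCTS R n m)
    (xs : 'M[R]_(n, m)) :
  (forall i i' : 'I_n, (i <= i')%N -> fixed_cost P i' <= fixed_cost P i) ->
  (forall j j' : 'I_m, (j <= j')%N -> (demand P j' <= demand P j)%N) ->
  feasible P xs ->
  (forall j : 'I_m, exists! i : 'I_n, 0 < xs i j) ->
  (n * q < m)%N ->
  exists x : 'M[R]_(n, m),
    [/\ feasible P x,
        q%:R * cost P x <= (q%:R + 1) * cost P xs &
        forall (i i' : 'I_n) (j j' : 'I_m), (j < n * q)%N -> (n * q <= j')%N ->
          0 < x i j -> 0 < x i' j' -> (i <= i')%N].
Proof.
move=> fmono bmono [xs0 xsrow xscol] xsuniq ltQm.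
(* The data are extended from ordinals to [nat] by 0, which keeps [b] and [f] nonincreasing. *)
pose b j := oapp (demand P) 0%N (insub j).
pose f i := oapp (fixed_cost P) 0 (insub i).
pose src (j : 'I_m) : nat := oapp (@nat_of_ord n) 0%N [pick i | 0 < xs i j].
pose s j := oapp src 0%N (insub j).
have bE (j : 'I_m) : b j = demand P j by rewrite /b valK.
have fE (i : 'I_n) : f i = fixed_cost P i by rewrite /f valK.
have sE (i : 'I_n) (j : 'I_m) : (s j == i) = (0 < xs i j).
  rewrite /s valK /= /src; have [i0 [xi0 uni]] := xsuniq j.
  case: pickP => [i1 xi1 | /(_ i0)]; last by rewrite xi0.
  apply/eqP/idP => [/val_inj <- //|xi].
  by rewrite /= -(uni _ xi1) (uni _ xi).
have b_mono j j' : (j <= j')%N -> (b j' <= b j)%N.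
  move=> le_jj'; rewrite /b; case: insubP => [u' _ Eu'|] //=.
  case: insubP => [u _ Eu|] /=; last first.
    by have := ltn_ord u'; rewrite -[nat_of_ord u']/(val u') Eu'; lia.
  by apply: bmono; rewrite Eu Eu'.
have f0 i : 0 <= f i.
  by rewrite /f; case: insubP => //= u _ _; apply: fixed_cost_ge0.
have f_mono i : f i.+1 <= f i.
  rewrite {1}/f; case: insubP => [u' _ Eu'|] //=.
  rewrite /f; case: insubP => [u _ Eu|] /=; last first.
    by have := ltn_ord u'; rewrite -[nat_of_ord u']/(val u') Eu'; lia.
  by apply: fmono; rewrite Eu Eu'.
have s_lt j : (j < m)%N -> (s j < n)%N.
  move=> ltj; have [i0 [xi0 _]] := xsuniq (Ordinal ltj).
  by have := sE i0 (Ordinal ltj); rewrite xi0 => /eqP /= ->.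
(* The only source serving [j] ships its whole demand, so [xs] is determined by [s]. *)
have xsE : xs = \matrix_(i, j) (if s j == i then b j else 0%N)%:R.
  apply/matrixP => i j; rewrite mxE sE; case: ifP => xij; last first.
    by apply/eqP; move: xij; rewrite lt0r xs0 andbT => /negbT; rewrite negbK.
  rewrite bE -xscol (bigD1 i) //= big1 ?addr0 // => i' ne_i'i.
  apply/eqP; move: (xs0 i' j); rewrite le0r => /orP[//|].
  move: xij; rewrite -!sE => /eqP Ei /eqP Ei'; case/negP: ne_i'i.
  by apply/eqP/val_inj; rewrite /= -Ei -Ei'.
have aE (i : 'I_n) : supply P i = (\sum_(0 <= j < m | s j == i) b j)%N.
  apply/eqP; rewrite -(eqr_nat R) -xsrow big_mkord natr_sum; apply/eqP.
  rewrite [RHS]big_mkcond /=; apply: eq_bigr => j _; rewrite {1}xsE mxE.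
  by case: (_ == _).
pose d i := (\sum_(0 <= j < m) (s j == i))%N.
have Dn : (\sum_(0 <= i < n) d i = m)%N.
  rewrite sum_degree big_nat -[RHS]subn0 -[RHS]muln1 -sum_nat_const_nat [RHS]big_nat.
  by apply: eq_bigr => j /andP[_ /s_lt ->].
have costE : cost P xs = \sum_(0 <= i < n) f i * (d i)%:R.
  rewrite xsE (cost_nat_mx (fun i j => if s j == i then b j else 0%N) fE).
  apply: eq_bigr => i _; congr (_ * _%:R).
  apply: eq_big_nat => j /andP[_ ltj]; case: ifP => // _.
  by rewrite -[j]/(val (Ordinal ltj)) bE demand_gt0.
have n_gt0 : (0 < n)%N.
  by have := s_lt _ ltQm; case: (n).
have leQD : (n * q <= \sum_(0 <= i < n) d i)%N by rewrite Dn ltnW.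
have [c [lt_cn D_le D_ge]] := exists_threshold n_gt0 leQD.
have [X [Xrow Xcol Xsep Xdeg Xpre]] := rounding b_mono s_lt lt_cn ltQm D_le.
exists (\matrix_(i, j) (X i j)%:R); split.
- split=> [i j|i|j]; first by rewrite mxE ler0n.
    rewrite aE -Xrow // natr_sum big_mkord; apply: eq_bigr => j _.
    by rewrite mxE.
  rewrite -bE -Xcol // natr_sum big_mkord; apply: eq_bigr => i _.
  by rewrite mxE.
- have sum1 (w N : nat) :
      (\sum_(0 <= i < N) (if i == c then w else 0) = if c < N then w else 0)%N.
    by rewrite -big_mkcond big_nat1_eq.
  (* A weight [n * q] placed at [c] has prefix sums at most those of [d]: by [D_ge] the first [c.+1]
     sources already have [n * q] edges. *)
  have le1 : f c * (n * q)%:R <= cost P xs.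
    have -> : f c * (n * q)%:R =
        \sum_(0 <= i < n) f i * (if i == c then n * q else 0)%N%:R.
      under eq_bigr => i _ do
        rewrite (fun_if (GRing.natmul 1)) mulr0n (fun_if ( *%R (f i))) mulr0.
      by rewrite -big_mkcond big_nat1_eq /= lt_cn.
    rewrite costE; apply: ler_sum_prefix => // k _; rewrite sum1.
    by case: ltnP => // lt_ck; apply: leq_trans D_ge (leq_sum_widen _ lt_ck).
  (* The extra edges are charged at [c]: prefixes up to [c] need none by [Xdeg], longer ones at most
     [n] by [Xpre]. *)
  have le2 : cost P (\matrix_(i, j) (X i j)%:R) <= cost P xs + f c * n%:R.
    have -> : cost P xs + f c * n%:R =
        \sum_(0 <= i < n) f i * (d i + if i == c then n else 0)%N%:R.
      under eq_bigr => i _ do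
        rewrite natrD mulrDr (fun_if (GRing.natmul 1)) mulr0n
          (fun_if ( *%R (f i))) mulr0.
      by rewrite big_split -big_mkcond big_nat1_eq /= lt_cn costE.
    rewrite (cost_nat_mx _ fE); apply: ler_sum_prefix => // k le_kn.
    rewrite big_split /= sum1; case: ltnP => [lt_ck|le_kc].
      by apply: leq_trans (Xpre _ lt_ck) _; rewrite leq_add2l.
    rewrite addn0 !big_nat; apply: leq_sum => i /andP[_ lt_ik].
    by apply: Xdeg; lia.
  apply: le_trans (ler_wpM2l (ler0n R q) le2) _.
  by rewrite mulrDr mulrDl mul1r lerD2l mulrC -mulrA -natrM.
move=> i i' j j' ltj lej'; rewrite !mxE !ltr0n; exact: Xsep.
Qed.

Theorem theorem8p1 (R : realType) :
  exists eps0 : R, 0 < eps0 /\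
  forall (eps : R) (q : nat), 0 < eps -> eps <= eps0 -> eps^-1 = q%:R ->
  forall (n m : nat) (P : PFCTS R n m),
    (forall i i' : 'I_n, (i <= i')%N -> fixed_cost P i' <= fixed_cost P i) ->
    (forall j j' : 'I_m, (j <= j')%N -> (demand P j' <= demand P j)%N) ->
  forall xs : 'M[R]_(n, m),
    optimum P xs ->
    (forall j : 'I_m, exists! i : 'I_n, 0 < xs i j) ->
  exists x : 'M[R]_(n, m),
    [/\ feasible P x,
        cost P x <= (1 + eps) * cost P xs
      & exists E : {set 'I_n * 'I_m},
          most_expensive P (n * q) (supp x) E /\
          forall e : 'I_n * 'I_m, e \in E -> (e.2 < n * q)%N].
Proof.
exists 1; split=> // eps q eps0 _ epsq n m P fmono bmono xs [xsfeas _] xsuniq.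
(* With at most [n * q] sinks every edge qualifies, and [xs] itself serves. *)
have [le_mQ|lt_Qm] := leqP m (n * q)%N.
  have [E _ topE] : exists2 E : {set 'I_n * 'I_m},
      E \subset supp xs & most_expensive P (n * q) (supp xs) E.
    apply: most_expensive_subset; rewrite ?geq_minr // => e e' _.
    by rewrite setDv inE.
  exists xs; split=> //.
    rewrite mulrDl mul1r lerDl mulr_ge0 ?(ltW eps0) //.
    by do 2!apply: sumr_ge0 => ? _; case: ifP => // _; apply: fixed_cost_ge0.
  by exists E; split=> // e _; apply: leq_trans (ltn_ord _) le_mQ.
have [x [xfeas xcost xsep]] := rounded_solution fmono bmono xsfeas xsuniq lt_Qm.
have [x0 xrow xcol] := xfeas.
have xgt0 i j : (0 < x i j) = (x i j != 0) by rewrite lt0r x0 andbT.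
(* By separation, the edges at the first [n * q] sinks cost at least as much as all others, so [E]
   can be chosen among them. *)
have [E sEB topE] : exists2 E : {set 'I_n * 'I_m},
    E \subset [set e in supp x | (e.2 < n * q)%N]
    & most_expensive P (n * q) (supp x) E.
  apply: most_expensive_subset => [|e e'|].
  - by apply/subsetP => e; rewrite inE => /andP[].
  - rewrite !inE => /andP[xe lt_e] /andP[+ xe']; rewrite xe' /= -leqNgt => le_e'.
    by apply: fmono; apply: xsep lt_e le_e' _ _; rewrite xgt0.
  (* Each of the first [n * q] sinks has positive demand, hence an edge; projecting edges to sinks
     shows that there are enough. *)
  apply: leq_trans (geq_minl _ _) _.
  have le_Qm := ltnW lt_Qm.
  have cardQ : #|[set widen_ord le_Qm j | j : 'I_(n * q)]| = (n * q)%N.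
    rewrite card_imset ?card_ord // => j j' /(congr1 val) /= E.
    exact: val_inj.
  rewrite -[leqLHS]cardQ; apply: leq_trans (leq_imset_card snd _).
  apply: subset_leq_card.
  apply/subsetP => _ /imsetP[j _ ->]; set j' := widen_ord _ _.
  have /existsP[i xij] : [exists i, x i j' != 0].
    apply: contraT => /existsPn x_eq0; have := xcol j'.
    rewrite big1 => [/esym/eqP|i _]; last by have := x_eq0 i; rewrite negbK => /eqP.
    by rewrite pnatr_eq0 => /eqP E; have := demand_gt0 P j'; rewrite E.
  by apply/imsetP; exists (i, j') => //; rewrite !inE xij /= ltn_ord.
exists x; split=> //.
  have q0 : 0 < q%:R :> R by rewrite -epsq invr_gt0.
  have epsE : eps = q%:R^-1 by rewrite -epsq invrK.
  rewrite -(ler_pM2l q0); apply: le_trans xcost _.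
  by rewrite mulrA mulrDr mulr1 epsE divff // gt_eqF.
by exists E; split=> // e /(subsetP sEB); rewrite inE => /andP[].
Qed.
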